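(* In the binary classification setting of the context (method (M1), margin $h$), let $\mathcal{G}=\{\tilde s(\alpha,\beta):\ \alpha>\alpha_0,\ \beta>\beta_0\}$, let $\mathcal{K}$ be its (finite) cardinality, and let $\tilde{\tilde s}$ be a minimizer of $\gamma_{n_3}$ over $\mathcal{G}$. For any $\eta\in(0,1)$, $$\mathbb{E}\big[l(s,\tilde{\tilde s})\mid\mathcal{L}_1,\mathcal{L}_2\big]\le\frac{1+\eta}{1-\eta}\inf_{(\alpha,\beta)}\big\{l(s,\tilde s(\alpha,\beta))\big\}+\frac{\left(\frac13+\frac1\eta\right)\frac{1}{1-\eta}}{n_3h}\log\mathcal{K}+\frac{\frac{2\eta+\frac13+\frac1\eta}{1-\eta}}{n_3h},$$ where the infimum is over $\alpha>\alpha_0$, $\beta>\beta_0$.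
   Context: Setting. $(X,Y)$ is a random pair with $X=(X^1,\dots,X^p)\in\mathbb{R}^p$ and $Y\in\{0,1\}$; the regression function is $x\mapsto\mathbb{E}[Y\mid X=x]$ and the Bayes classifier is $s(x)=\mathbf{1}_{\mathbb{E}[Y\mid X=x]\ge1/2}$. The loss is $l(s,u)=\mathbb{P}(Y\ne u(X))-\mathbb{P}(Y\ne s(X))$ for $u:\mathbb{R}^p\to\{0,1\}$; for a data-dependent predictor, $l(s,\cdot)$ is evaluated at that predictor. Margin condition: there is $h>0$ with $|2\,\mathbb{E}[Y\mid X=x]-1|\ge h$ for all $x\in\mathbb{R}^p$. Samples (case (M1)). The training sample of independent copies of $(X,Y)$ is split into independent subsamples $\mathcal{L}_1,\mathcal{L}_2,\mathcal{L}_3$ of sizes $n_1,n_2,n_3$. For $k\in\{2,3\}$, $\gamma_{n_k}(u)=\frac1{n_k}\sum_{(X_i,Y_i)\in\mathcal{L}_k}(Y_i-u(X_i))^2$. Models. $\Lambda=\{X^1,\dots,X^p\}$ is the set of explanatory variables and $\mathcal{P}(\Lambda)$ the collection of its (nonempty) subsets $M$. For each $M$, $T_{max}^{(M)}$ is the maximal binary tree built by the CART growing procedure from $\mathcal{L}_1$, using only admissible splits (questions $X^j\le c$) on variables $X^j\in M$: starting from the root $\mathbb{R}^p$, nodes are recursively split in two by the admissible split maximizing the decrease of an impurity function (e.g. the Gini index), until each terminal node contains one observation or observations with the same response. $T\preceq T_{max}^{(M)}$ means that $T$ is a pruned subtree (same root, obtained by cutting branches), $|T|$ is its number of leaves, and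 $S_{M,T}$ is the set of $\{0,1\}$-valued functions constant on each cell of the partition of $\mathbb{R}^p$ given by the leaves of $T$. $\hat s_{M,T}$ is a minimizer of $\gamma_{n_2}$ over $S_{M,T}$. Penalized estimators. $\alpha_0,\beta_0>0$ are fixed absolute constants. For $\alpha>\alpha_0$, $\beta>\beta_0$, $\tilde s(\alpha,\beta)=\hat s_{\widehat{(M,T)}}$, where $\widehat{(M,T)}$ minimizes $\gamma_{n_2}(\hat s_{M,T})+pen(M,T)$ over all $M\in\mathcal{P}(\Lambda)$, $T\preceq T_{max}^{(M)}$, with $$pen(M,T)=\alpha\frac{|T|}{n_2h}+\beta\frac{|M|}{n_2h}\left(1+\log\left(\frac{p}{|M|}\right)\right).$$ Since there are finitely many pairs $(M,T)$, $\mathcal{G}$ is finite. *)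

(* Defs.v *)
From HB Require Import structures.
From mathcomp Require Import all_boot all_order all_algebra finmap.
From mathcomp Require Import all_classical all_reals all_analysis.

Set Implicit Arguments.
Unset Strict Implicit.
Unset Printing Implicit Defensive.

Import Order.TTheory GRing.Theory Num.Theory.
Import numFieldNormedType.Exports.

Local Open Scope classical_set_scope.
Local Open Scope ring_scope.

(* R^p is p.-tuple R with its product sigma-algebra; the labels {0,1} are bool. *)
Notation obs R p := (p.-tuple R * bool)%type.
Notation sample R p n := (n.-tuple (p.-tuple R * bool)).
Notation classifier R p := (p.-tuple R -> bool).

Section Probability.
Context {d : measure_display} {Omega : measurableType d} {R : realType}.
Variable P : probability Omega R.

Definition mutually_independent {d' : measure_display} {E : measurableType d'}
    {I : finType} (Z : I -> Omega -> E) : Prop :=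
  forall (J : {set I}) (B : I -> set E), (forall i, measurable (B i)) ->
    P (\bigcap_(i in [set i | i \in J]) (Z i @^-1` B i))
    = (\prod_(i in J) P (Z i @^-1` B i))%E.

(* Only measurable events are compared: P is arbitrary on other sets. *)
Definition same_law {d' : measure_display} {E : measurableType d'}
    (Z Z' : Omega -> E) : Prop :=
  forall B : set E, measurable B -> P (Z @^-1` B) = P (Z' @^-1` B).

(* V is a version of E[f | sigma(L)]; the events of sigma(L) are the sets
   L @^-1` B with B measurable. *)
Definition is_cond_expectation {d' : measure_display} {E : measurableType d'}
    (L : Omega -> E) (f V : Omega -> R) : Prop :=
  [/\ P.-integrable setT (EFin \o f),
      P.-integrable setT (EFin \o V),
      forall A : set R, measurable A ->
        preimage_set_system setT L measurable (V @^-1` A)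
    & forall B : set E, measurable B ->
        (\int[P]_(w in L @^-1` B) (V w)%:E
         = \int[P]_(w in L @^-1` B) (f w)%:E)%E].

End Probability.

Section Classification.
Context {d : measure_display} {Omega : measurableType d} {R : realType}.
Context {p : nat}.
Variables (P : probability Omega R) (XY : Omega -> obs R p).

(* r(x) = E[Y | X = x]. *)
Definition is_regression (r : p.-tuple R -> R) : Prop :=
  measurable_fun setT r /\
  is_cond_expectation P (fun w => (XY w).1)
    (fun w => (XY w).2%:R) (fun w => r (XY w).1).

Definition bayes (r : p.-tuple R -> R) : classifier R p :=
  fun x => 2^-1 <= r x.

Definition margin (r : p.-tuple R -> R) (h : R) : Prop :=
  forall x, h <= `|2 * r x - 1|.

(* u is a fixed function, so that for a data-dependent predictor the
   probabilities are taken over (X, Y) only. *)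
Definition loss (s u : classifier R p) : R :=
  fine (P [set w | (XY w).2 != u (XY w).1])
  - fine (P [set w | (XY w).2 != s (XY w).1]).

End Classification.

Definition empirical_risk {R : realType} {p n : nat} (D : sample R p n)
    (u : classifier R p) : R :=
  n%:R^-1 * \sum_(i < n) ((tnth D i).2%:R - (u (tnth D i).1)%:R) ^+ 2.

(* Node j c Tl Tr asks "X^j <= c ?"; Tl is the "yes" branch. *)
Inductive tree (R : Type) (p : nat) : Type :=
  | Leaf
  | Node of 'I_p & R & tree R p & tree R p.
Arguments Leaf {R p}.

Section Trees.
Context {R : realType} {p : nat}.

Fixpoint nleaves (T : tree R p) : nat :=
  if T is Node _ _ Tl Tr then (nleaves Tl + nleaves Tr)%N else 1%N.

(* The address, as a sequence of answers, of the leaf whose cell contains x. *)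
Fixpoint leaf_of (T : tree R p) (x : p.-tuple R) : seq bool :=
  if T is Node j c Tl Tr then
    if tnth x j <= c then true :: leaf_of Tl x else false :: leaf_of Tr x
  else [::].

(* The model S_{M,T}. *)
Definition tree_model (T : tree R p) : set (classifier R p) :=
  [set u | forall x y, leaf_of T x = leaf_of T y -> u x = u y].

Fixpoint pruned (T T' : tree R p) : Prop :=
  match T, T' with
  | Leaf, _ => True
  | Node j c Tl Tr, Node j' c' Tl' Tr' =>
      [/\ j = j', c = c', pruned Tl Tl' & pruned Tr Tr']
  | Node _ _ _ _, Leaf => False
  end.

(* Two-class impurity function of Breiman et al., as a function on [0, 1] of the
   proportion of the class 1: symmetric in the two classes, maximal only at the
   uniform proportions, minimal only at the pure ones.  The Gini index is
   q |-> 2 * q * (1 - q). *)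
Definition is_impurity (phi : R -> R) : Prop :=
  [/\ forall q, 0 <= q <= 1 -> phi (1 - q) = phi q,
      forall q, 0 <= q <= 1 -> q != 2^-1 -> phi q < phi 2^-1
    & forall q, 0 < q < 1 -> phi 0 < phi q].

(* In what follows a node is represented by the observations D it contains. *)

Definition yes_part (D : seq (obs R p)) (j : 'I_p) (c : R) :=
  [seq z <- D | tnth z.1 j <= c].

Definition no_part (D : seq (obs R p)) (j : 'I_p) (c : R) :=
  [seq z <- D | ~~ (tnth z.1 j <= c)].

Definition impurity (phi : R -> R) (D : seq (obs R p)) : R :=
  phi ((count (fun z => z.2) D)%:R / (size D)%:R).

Definition impurity_decrease (phi : R -> R) (D : seq (obs R p))
    (j : 'I_p) (c : R) : R :=
  impurity phi D
  - (size (yes_part D j c))%:R / (size D)%:R * impurity phi (yes_part D j c)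
  - (size (no_part D j c))%:R / (size D)%:R * impurity phi (no_part D j c).

(* A question that leaves one of the two children without observation does not
   split the node. *)
Definition admissible (M : {set 'I_p}) (D : seq (obs R p)) (j : 'I_p) (c : R)
    : Prop :=
  [/\ j \in M, (0 < size (yes_part D j c))%N & (0 < size (no_part D j c))%N].

(* The last case covers observations with different responses that share the
   values of all the variables of M, which no question on M can separate. *)
Definition terminal (M : {set 'I_p}) (D : seq (obs R p)) : Prop :=
  [\/ (size D <= 1)%N,
      constant [seq z.2 | z <- D]
    | forall j c, ~ admissible M D j c].

(* T is a maximal tree grown from D with the variables of M.  Ties between
   questions of maximal decrease are broken arbitrarily. *)
Fixpoint cart_maximal (phi : R -> R) (M : {set 'I_p}) (D : seq (obs R p))
    (T : tree R p) : Prop :=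
  match T with
  | Leaf => terminal M D
  | Node j c Tl Tr =>
      [/\ ~ terminal M D,
          admissible M D j c,
          forall j' c', admissible M D j' c' ->
            impurity_decrease phi D j' c' <= impurity_decrease phi D j c,
          cart_maximal phi M (yes_part D j c) Tl
        & cart_maximal phi M (no_part D j c) Tr]
  end.

End Trees.

Definition is_minimizer {R : realType} {E : Type} (A : set E) (f : E -> R)
    (a : E) : Prop :=
  A a /\ forall b, A b -> f a <= f b.

Definition penalty {R : realType} (p n : nat) (h alpha beta : R)
    (M : {set 'I_p}) (T : tree R p) : R :=
  alpha * ((nleaves T)%:R / (n%:R * h))
  + beta * (#|M|%:R / (n%:R * h)) * (1 + ln (p%:R / #|M|%:R)).

(* The pairs (M, T) with M nonempty and T a pruned subtree of Tmax M. *)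
Definition model_index {R : realType} {p : nat}
    (Tmax : {set 'I_p} -> tree R p) : set ({set 'I_p} * tree R p) :=
  [set MT : {set 'I_p} * tree R p | (0 < #|MT.1|)%N /\ pruned MT.2 (Tmax MT.1)].

(* The estimators are deterministic functions of the subsamples they are
   built from.  Trees are grown on the first subsample. *)
Definition is_maximal_tree_rule {R : realType} {p n1 : nat} (phi : R -> R)
    (Tmax : sample R p n1 -> {set 'I_p} -> tree R p) : Prop :=
  forall (D1 : sample R p n1) (M : {set 'I_p}), (0 < #|M|)%N -> cart_maximal phi M D1 (Tmax D1 M).

Section Estimators.
Context {R : realType} {p n1 n2 : nat}.
Variable Tmax : sample R p n1 -> {set 'I_p} -> tree R p.

(* shat D1 D2 (M, T) is the estimator \hat s_{M,T}. *)
Definition is_erm_rule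
    (shat : sample R p n1 -> sample R p n2 -> {set 'I_p} * tree R p ->
            classifier R p) : Prop :=
  forall D1 D2 MT, model_index (Tmax D1) MT ->
    is_minimizer (tree_model MT.2) (empirical_risk D2) (shat D1 D2 MT).

Variable shat : sample R p n1 -> sample R p n2 -> {set 'I_p} * tree R p ->
  classifier R p.

(* sel D1 D2 alpha beta is the selected pair \hat{(M,T)}. *)
Definition is_selection_rule (h alpha0 beta0 : R)
    (sel : sample R p n1 -> sample R p n2 -> R -> R -> {set 'I_p} * tree R p)
    : Prop :=
  forall D1 D2 alpha beta, alpha0 < alpha -> beta0 < beta ->
    is_minimizer (model_index (Tmax D1))
      (fun MT => empirical_risk D2 (shat D1 D2 MT)
                 + penalty n2 h alpha beta MT.1 MT.2)
      (sel D1 D2 alpha beta).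

End Estimators.

Section Aggregation.
Context {R : realType} {p n1 n2 : nat}.
Variables (shat : sample R p n1 -> sample R p n2 -> {set 'I_p} * tree R p ->
                  classifier R p)
  (sel : sample R p n1 -> sample R p n2 -> R -> R -> {set 'I_p} * tree R p).

Definition stilde (D1 : sample R p n1) (D2 : sample R p n2) (alpha beta : R)
    : classifier R p :=
  shat D1 D2 (sel D1 D2 alpha beta).

Definition candidates (alpha0 beta0 : R) (D1 : sample R p n1)
    (D2 : sample R p n2) : set (classifier R p) :=
  [set u | exists alpha beta, [/\ alpha0 < alpha, beta0 < beta
                                & u = stilde D1 D2 alpha beta]].

Definition is_holdout_rule {n3 : nat} (alpha0 beta0 : R)
    (sfinal : sample R p n1 -> sample R p n2 -> sample R p n3 ->
              classifier R p) : Prop :=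
  forall D1 D2 D3,
    is_minimizer (candidates alpha0 beta0 D1 D2) (empirical_risk D3)
      (sfinal D1 D2 D3).

End Aggregation.

(* fset_set is the finite set of elements of a (classically) finite set; its
   value is irrelevant for an infinite one. *)
Definition cardinality {E : choiceType} (G : set E) : nat := #|` fset_set G|.

(* Main.v *)
Require Import Defs.
From HB Require Import structures.
From mathcomp Require Import all_boot all_order all_algebra finmap ring lra.
From mathcomp Require Import all_classical all_reals all_analysis measurable_realfun.

Set Implicit Arguments.
Unset Strict Implicit.
Unset Printing Implicit Defensive.

Import Order.TTheory GRing.Theory Num.Theory.
Import numFieldNormedType.Exports.

Local Open Scope classical_set_scope.
Local Open Scope ring_scope.

(** Write s for the Bayes classifier, G for the set of candidates, l u for the
    loss of u, and let v be any element of G.  Fix the first two subsamples; then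
    G is a finite set of measurable classifiers, because a tree has finitely many
    pruned subtrees and a tree model contains finitely many classifiers.

    Put lam = eta * h, and for u in G let S u be the number of errors of v on the
    third subsample minus the number of errors of u.  Each of its n3 summands
    has values in {-1, 0, 1} and square the indicator of u <> v, so
    expR x <= 1 + x + x ^+ 2 bounds the expectation of expR (lam * S u) by
    expR (n3 * lam * (l v - l u + lam * P (u <> v))).  The margin condition gives
    h * P (u <> s) <= l u, whence lam * P (u <> v) <= eta * (l u + l v)
    ([disagreement_le_losses]) and the expectation of
    expR (lam * S u + n3 * lam * ((1 - eta) * l u - (1 + eta) * l v)) is at most 1
    ([exponential_comparison]).  The sum over G of these exponentials has
    expectation at most the cardinality K of G.  The hold-out choice satisfies
    S >= 0, so the sum is at least
    expR (n3 * lam * ((1 - eta) * L - (1 + eta) * l v)) with L the loss of that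
    choice; 1 + x <= expR x, applied to this exponent minus ln K, gives
    (1 - eta) * E[L] <= (1 + eta) * l v + ln K / (n3 * eta * h)
    ([holdout_inequality]).  Dividing by 1 - eta gives the bound, because
    1 / eta <= 1 / 3 + 1 / eta and the last term of the bound is nonnegative.

    To pass from fixed to random subsamples, the pi-lambda theorem turns the
    mutual independence of the observations into the independence of the first
    two subsamples and the third one ([blocks_independent]), so that by Fubini
    the expectation over the third subsample alone, evaluated at the first two,
    is a version of the conditional expectation
    ([cond_expectation_independent]); two versions are almost surely ordered
    ([cond_expectation_le]).  The infimum and the cardinality in the bound need
    not be measurable functions of the first two subsamples: the bound holds at
    every point for this version, and only versions are compared almost
    surely. *)

(** * An exponential inequality *)

(** For x > 0 the function t |-> (1 + t + t ^+ 2) * expR (- t), with derivative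
    t * (1 - t) * expR (- t), increases from 1 on [0, 1]; for x <= 0 the bound
    expR x <= (1 - x)^-1 is enough. *)
Lemma expR_le_quadratic (R : realType) (x : R) : `|x| <= 1 ->
  expR x <= 1 + x + x ^+ 2.
Proof.
rewrite ler_norml => /andP[x1 x2].
have [x0|x0] := lerP x 0.
  have : (1 - x) * expR x <= 1.
    rewrite -ler_pdivlMr ?expR_gt0// div1r -expRN; exact: expR_ge1Dx.
  have := expR_gt0 x; nra.
pose k (t : R) := (1 + t + t ^+ 2) * expR (- t).
have dk (t : R) : is_derive t 1 k (t * (1 - t) * expR (- t)).
  by rewrite /k; apply: is_derive_eq; rewrite /GRing.scale/=; ring.
suff : k 0 <= k x.
  by rewrite /k oppr0 expR0 expRN ler_pdivlMr ?expR_gt0//; lra.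
apply: (@ger0_derive1_ndecr _ k 0 1) => //; last exact: ltW.
- move=> t; rewrite in_itv/= => /andP[t0 t1].
  rewrite derive1E derive_val mulr_ge0 ?expR_ge0//; nra.
- by apply: derivable_within_continuous => t _; exact: ex_derive.
Qed.

(** * Tree models *)

(** The factorization of u through the leaf addresses restricts to the two
    subtrees of a node, which allows inductions on the tree. *)
Lemma tree_modelP (R : realType) (p : nat) (T : tree R p) u :
  tree_model T u <-> exists phi : seq bool -> bool, u = phi \o leaf_of T.
Proof.
split=> [Tu|[phi ->] x y /= -> //].
exists (fun a => `[< exists2 x, leaf_of T x = a & u x >]).
apply/funext => x /=; apply/idP/asboolP => [ux|[y /Tu <- //]].
by exists x.
Qed.

Lemma measurable_tree_model (R : realType) (p : nat) (T : tree R p) u :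
  tree_model T u -> measurable_fun setT u.
Proof.
move=> /tree_modelP[phi ->{u}].
elim: T phi => [|j c Tl IHl Tr IHr] phi /=; first exact: measurable_cst.
rewrite (_ : _ \o _ = fun x => if tnth x j <= c
    then (phi \o cons true \o leaf_of Tl) x
    else (phi \o cons false \o leaf_of Tr) x); last first.
  by apply/funext => x /=; case: ifP.
apply: measurable_fun_ifT => //=.
apply: measurable_fun_ler => //; exact: measurable_tnth.
Qed.

Lemma finite_tree_model (R : realType) (p : nat) (T : tree R p) :
  finite_set (tree_model T).
Proof.
elim: T => [|j c Tl IHl Tr IHr].
  apply: (@sub_finite_set _ _ [set cst true; cst false]); last exact: finite_set2.
  move=> u /tree_modelP[phi ->] /=; case E : (phi [::]); [left|right];
    by apply/funext => x /=.
have := @finite_image2 _ _ _ _ _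
  (fun u v (x : p.-tuple R) => if tnth x j <= c then u x else v x : bool) IHl IHr.
apply: sub_finite_set => u /tree_modelP[phi ->].
exists (phi \o cons true \o leaf_of Tl).
  by apply/tree_modelP; exists (phi \o cons true).
exists (phi \o cons false \o leaf_of Tr).
  by apply/tree_modelP; exists (phi \o cons false).
by apply/funext => x /=; case: ifP.
Qed.

Lemma finite_pruned (R : realType) (p : nat) (T : tree R p) :
  finite_set [set T' | pruned T' T].
Proof.
elim: T => [|j c Tl IHl Tr IHr].
  by apply: (@sub_finite_set _ _ [set @Leaf R p]) => // -[].
have := finite_image2 (Node j c) IHl IHr.
move=> /(conj (finite_set1 (@Leaf R p))); rewrite -finite_setU.
apply: sub_finite_set => -[|j' c' Tl' Tr'] /=; first by left.
by case=> -> -> pl pr; right; exists Tl' => //; exists Tr'.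
Qed.

Lemma candidates_sub (R : realType) (p n1 n2 : nat) Tmax
    (shat : sample R p n1 -> sample R p n2 -> {set 'I_p} * tree R p ->
      classifier R p) sel h alpha0 beta0 D1 D2 :
  is_erm_rule Tmax shat -> is_selection_rule Tmax shat h alpha0 beta0 sel ->
  candidates shat sel alpha0 beta0 D1 D2 `<=`
    \bigcup_(M in setT)
      \bigcup_(T in [set T | pruned T (Tmax D1 M)]) tree_model T.
Proof.
move=> erm ms u [a [b [aa bb ->]]].
have [MT _] := ms D1 D2 _ _ aa bb.
exists (sel D1 D2 a b).1 => //; exists (sel D1 D2 a b).2; first by case: MT.
by have [] := erm D1 D2 _ MT.
Qed.

Lemma finite_candidates (R : realType) (p n1 n2 : nat) Tmax
    (shat : sample R p n1 -> sample R p n2 -> {set 'I_p} * tree R p ->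
      classifier R p) sel h alpha0 beta0 D1 D2 :
  is_erm_rule Tmax shat -> is_selection_rule Tmax shat h alpha0 beta0 sel ->
  finite_set (candidates shat sel alpha0 beta0 D1 D2).
Proof.
move=> erm ms; apply: sub_finite_set (candidates_sub erm ms) _.
apply: bigcup_finite => [|M _]; first exact: finite_finset.
by apply: bigcup_finite => [|T _]; [exact: finite_pruned|exact: finite_tree_model].
Qed.

Lemma candidates_measurable (R : realType) (p n1 n2 : nat) Tmax
    (shat : sample R p n1 -> sample R p n2 -> {set 'I_p} * tree R p ->
      classifier R p) sel h alpha0 beta0 D1 D2 u :
  is_erm_rule Tmax shat -> is_selection_rule Tmax shat h alpha0 beta0 sel ->
  candidates shat sel alpha0 beta0 D1 D2 u -> measurable_fun setT u.
Proof.
move=> erm ms /(candidates_sub erm ms)[M _ [T _ Tu]].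
exact: measurable_tree_model Tu.
Qed.

(** * Independence of blocks of a mutually independent family *)

Section Independence.
Context {d : measure_display} {Omega : measurableType d} {R : realType}.
Variable P : probability Omega R.
Context {d' : measure_display} {E : measurableType d'}.

Lemma mutually_independent_comp (I I' : finType) (f : I' -> I)
    (Z : I -> Omega -> E) : injective f ->
  mutually_independent P Z -> mutually_independent P (Z \o f).
Proof.
move=> fI indZ J B mB.
pose B' i := if [pick j | f j == i] is Some j then B j else setT.
have B'f j : B' (f j) = B j.
  by rewrite /B'; case: pickP => [k /eqP/fI -> //|/(_ j)]; rewrite eqxx.
have mB' i : measurable (B' i) by rewrite /B'; case: pickP.
have := indZ (f @: J)%SET B' mB'.
rewrite big_imset/=; last by move=> ? ? _ _ /fI.
under eq_bigr do rewrite B'f.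
move=> <-; congr (P _); apply/seteqP; split=> w /= Hw.
  by move=> _ /imsetP[j jJ ->]; rewrite B'f; exact: Hw.
by move=> j jJ; have := Hw (f j); rewrite /= imset_f// B'f; exact.
Qed.

(** The events A that satisfy the product rule with B form a Dynkin system. *)
Lemma independent_sigma (G : set (set Omega)) (B : set Omega) :
  setI_closed G -> G `<=` measurable -> measurable B ->
  (forall A, G A -> P (A `&` B) = P A * P B)%E ->
  forall A, <<s G >> A -> P (A `&` B) = (P A * P B)%E.
Proof.
move=> GI Gm mB GB.
suff : <<s G >> `<=` [set A | measurable A /\ P (A `&` B) = (P A * P B)%E].
  by move=> H A /H[].
apply: lambda_system_subset => //; last by move=> A GA; split; [exact: Gm|exact: GB].
apply/dynkin_lambda_system; split => /=.
- by split=> //; rewrite setTI probability_setT mul1e.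
- move=> A [mA AB]; split; first exact: measurableC.
  have -> : ~` A `&` B = B `\` A by rewrite setDE setIC.
  rewrite measureD//; last by rewrite ltey_eq fin_num_measure.
  rewrite (setIC B); move: AB => /= ->; rewrite probability_setC// muleBl ?fin_num_measure//.
  by rewrite mul1e.
- move=> F tF FB; have mF n : measurable (F n) by case: (FB n).
  split; first exact: bigcup_measurable.
  rewrite setI_bigcupl measure_semi_bigcup//; last 3 first.
  + by move=> i; exact: measurableI.
  + by apply: trivIset_setIr.
  + by rewrite -setI_bigcupl; apply: measurableI => //; exact: bigcup_measurable.
  rewrite measure_semi_bigcup//; last exact: bigcup_measurable.
  rewrite muleC -[P B]fineK ?fin_num_measure// -nneseriesZl//.
  apply: eq_eseriesr => i _; have /= -> := (FB i).2.
  by rewrite fineK ?fin_num_measure// muleC.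
Qed.

Section Blocks.
Variables (I : finType) (Z : I -> {RV P >-> E}).

(** The pi-system that generates the sigma-algebra of the variables Z i, i in J. *)
Definition cylinders (J : {set I}) : set (set Omega) :=
  [set A | exists2 B : I -> set E, (forall i, measurable (B i)) &
           A = \bigcap_(i in [set i | i \in J]) (Z i @^-1` B i)].

Lemma measurable_cylinder J : cylinders J `<=` measurable.
Proof.
move=> _ [B mB ->]; apply: fin_bigcap_measurable => [|i _]; first exact: finite_finset.
by rewrite -[_ @^-1` _]setTI; exact: measurable_funPT.
Qed.

Lemma cylinders_setI J : setI_closed (cylinders J).
Proof.
move=> _ _ [B mB ->] [B' mB' ->]; exists (fun i => B i `&` B' i).
  by move=> i; exact: measurableI.
by rewrite -bigcapI.
Qed.

Lemma cylinders_independent (J J' : {set I}) A A' :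
  mutually_independent P (fun i => Z i : Omega -> E) ->
  [disjoint J & J']%B -> cylinders J A -> cylinders J' A' ->
  P (A `&` A') = (P A * P A')%E.
Proof.
move=> indZ JJ' [B mB ->] [B' mB' ->].
pose C i := if i \in J then B i else B' i.
have mC i : measurable (C i) by rewrite /C; case: ifP.
have CJ i : i \in J -> C i = B i by rewrite /C => ->.
have CJ' i : i \in J' -> C i = B' i by rewrite /C => /(disjointFl JJ') ->.
have := indZ (J :|: J')%SET C mC.
rewrite (eq_bigl [in [predU J & J']]); last by move=> i; rewrite !inE.
rewrite bigU//= (eq_bigr (fun i => P (Z i @^-1` B i))); last first.
  by move=> i iJ; rewrite CJ.
rewrite [X in (_ * X)%E](eq_bigr (fun i => P (Z i @^-1` B' i))); last first.
  by move=> i iJ; rewrite CJ'.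
rewrite -!indZ//; move=> <-; congr (P _); apply/seteqP; split=> w /=.
  move=> [H H'] i /=; rewrite inE => /orP[iJ|iJ].
    by rewrite CJ//; exact: H.
  by rewrite CJ'//; exact: H'.
by move=> H; split=> i /= iJ; [rewrite -CJ//|rewrite -CJ'//]; apply: H => /=;
  rewrite inE iJ ?orbT.
Qed.

(** The pi-lambda argument is applied to one block and then to the other: first
    A' is arbitrary and A varies, then A is a cylinder and A' varies. *)
Lemma blocks_independent (J J' : {set I}) A A' :
  mutually_independent P (fun i => Z i : Omega -> E) ->
  [disjoint J & J']%B -> <<s cylinders J >> A -> <<s cylinders J' >> A' ->
  P (A `&` A') = (P A * P A')%E.
Proof.
move=> indZ JJ' JA JA'.
have mA' : measurable A'.
  by apply: smallest_sub JA' => //; [exact: sigma_algebra_measurable|exact: measurable_cylinder].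
apply: (independent_sigma (@cylinders_setI J) (@measurable_cylinder J)) => // C JC.
rewrite setIC muleC; have mC := measurable_cylinder JC.
apply: (independent_sigma (@cylinders_setI J') (@measurable_cylinder J')) => // C' JC'.
by rewrite setIC muleC; exact: cylinders_independent JC JC'.
Qed.

Lemma cylinders_coordinate (J : {set I}) i B : i \in J -> measurable B ->
  cylinders J (Z i @^-1` B).
Proof.
move=> iJ mB; exists (fun j => if j == i then B else setT).
  by move=> j; case: ifP.
apply/seteqP; split=> w /= Hw; first by move=> j _ /=; case: ifP => // /eqP ->.
by have := Hw i iJ; rewrite /= eqxx.
Qed.

(** A statistic of the block J is measurable for the sigma-algebra of J once its
    coordinates are; this is the case of a coordinate. *)
Lemma measurable_block (J : {set I}) i : i \in J ->
  measurable_fun setT (Z i : g_sigma_algebraType (cylinders J) -> E).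
Proof.
move=> iJ _ B mB; rewrite setTI; apply: sub_sigma_algebra.
exact: cylinders_coordinate.
Qed.

End Blocks.
End Independence.

(** * Expectations of finitely valued variables *)

Lemma measurable_set_bool {d : measure_display} {T : measurableType d}
    (b : T -> bool) : measurable_fun setT b -> measurable [set x | b x].
Proof.
by move=> mb; rewrite -[X in measurable X]setTI; exact: (mb measurableT [set true]).
Qed.

Lemma measurable_neqb {d : measure_display} {T : measurableType d}
    (f g : T -> bool) :
  measurable_fun setT f -> measurable_fun setT g ->
  measurable_fun setT (fun w => f w != g w).
Proof.
move=> mf mg; rewrite (_ : (fun _ => _) =
  fun w => (f w && ~~ g w) || (~~ f w && g w)).
  by apply: measurable_or; apply: measurable_and => //; exact: measurable_neg.
by apply/funext => w; case: (f w); case: (g w).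
Qed.

Section FiniteValued.
Context {d : measure_display} {Omega : measurableType d} {R : realType}.
Variable P : probability Omega R.

Lemma integral_finite_valued (K : finType) (k : Omega -> K) (F : K -> R) :
  (forall c, measurable (k @^-1` [set c])) ->
  P.-integrable setT (EFin \o (F \o k)) /\
  \int[P]_w F (k w) = \sum_c F c * fine (P (k @^-1` [set c])).
Proof.
move=> mk.
have FE : EFin \o (F \o k) =
    fun w => (\sum_c ((F c)%:E * (\1_(k @^-1` [set c]) w)%:E))%E.
  apply/funext => w /=; rewrite (bigD1 (k w))//= indicE mem_set// mule1.
  rewrite big1 ?adde0// => c ck; rewrite indicE memNset ?mule0//=.
  by move=> kc; rewrite kc eqxx in ck.
have intF c : P.-integrable setT
    (fun w => (F c)%:E * (\1_(k @^-1` [set c]) w)%:E)%E.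
  by apply: integrableZl => //; exact: integrable_indic.
split; first by rewrite FE; exact: integrable_sum.
rewrite /Rintegral -[fun w => _]/(EFin \o (F \o k)) FE integral_sum//.
rewrite -sum_fine//; last by move=> c _; exact: integrable_fin_num.
apply: eq_bigr => c _; rewrite integralZl//; last exact: integrable_indic.
by rewrite integral_indic// setIT fineM ?fin_num_measure.
Qed.

Lemma Rintegral_cst_probability (c : R) : \int[P]_w c = c.
Proof.
rewrite Rintegral_cst// -[RHS]mulr1; congr (_ * _).
by rewrite -[RHS]/(fine 1%E); congr fine; exact: probability_setT.
Qed.

Lemma integral_bool (b : Omega -> bool) : measurable_fun setT b ->
  P.-integrable setT (fun w => ((b w)%:R : R)%:E) /\
  \int[P]_w (b w)%:R = fine (P [set w | b w]).
Proof.
move=> mb; have mk c : measurable (b @^-1` [set c]).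
  by rewrite -[_ @^-1` _]setTI; exact: mb.
have [ib ->] := @integral_finite_valued _ b (fun c => c%:R) mk.
by split => //; rewrite big_bool /= mul0r addr0 mul1r.
Qed.

(** Since e is finitely valued, the product is a finitely valued function of the
    random vector (e (Z i))_i, and the product rule for its fibres together with
    the distributivity of products over sums gives the factorization. *)
Lemma integral_prod_independent {d' : measure_display} {E : measurableType d'}
    (I K : finType) (Z : I -> {RV P >-> E}) (Z0 : {RV P >-> E})
    (e : E -> K) (g : K -> R) :
  mutually_independent P (fun i => Z i : Omega -> E) ->
  (forall i, same_law P (Z i) Z0) ->
  (forall c, measurable (e @^-1` [set c])) ->
  P.-integrable setT (fun w => (\prod_i g (e (Z i w)))%:E) /\
  \int[P]_w \prod_i g (e (Z i w)) = (\int[P]_w g (e (Z0 w))) ^+ #|I|.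
Proof.
move=> indZ lawZ me.
have mZ0 c : measurable ((e \o Z0) @^-1` [set c]).
  by rewrite -[_ @^-1` _]setTI comp_preimage; exact: measurable_funPT.
pose k w := [ffun i => e (Z i w)].
have kE (c : {ffun I -> K}) : k @^-1` [set c] =
    \bigcap_(i in [set i | i \in [set: I]%SET]) (Z i @^-1` (e @^-1` [set c i])).
  apply/seteqP; split=> w /=; first by move=> <- i _ /=; rewrite ffunE.
  by move=> H; apply/ffunP => i; rewrite ffunE; apply: H; rewrite /= inE.
have mk c : measurable (k @^-1` [set c]).
  rewrite kE; apply: fin_bigcap_measurable => [|i _]; first exact: finite_finset.
  by rewrite -[_ @^-1` _]setTI; exact: measurable_funPT.
have Pk c : fine (P (k @^-1` [set c])) =
    \prod_i fine (P ((e \o Z0) @^-1` [set c i])).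
  rewrite kE indZ// -[RHS]/(fine (\prod_i fine (P ((e \o Z0) @^-1` [set c i])))%:E).
  rewrite -prodEFin; congr fine; apply: eq_big => [i|i _]; first by rewrite inE.
  by rewrite fineK ?fin_num_measure// lawZ.
have [ik Ik] := @integral_finite_valued _ k (fun c => \prod_i g (c i)) mk.
have kp w : \prod_i g (k w i) = \prod_i g (e (Z i w)).
  by apply: eq_bigr => i _; rewrite ffunE.
split; first by move: ik; congr (integrable _ _); apply/funext => w /=; rewrite kp.
transitivity (\int[P]_w \prod_i g (k w i)); first by apply: eq_Rintegral => w _; rewrite kp.
rewrite Ik (integral_finite_valued g mZ0).2 -prodr_const bigA_distr_bigA/=.
by apply: eq_bigr => c _; rewrite Pk -big_split.
Qed.

End FiniteValued.

(** * Consequences of the margin condition *)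

Section Margin.
Context {d : measure_display} {Omega : measurableType d} {R : realType}.
Context {p : nat}.
Variables (P : probability Omega R) (XY : {RV P >-> obs R p}).

Definition error (u : classifier R p) : R :=
  fine (P [set w | (XY w).2 != u (XY w).1]).

Let mX : measurable_fun setT (fun w => (XY w).1).
Proof. by apply: measurableT_comp => //; exact: measurable_funPT. Qed.

Lemma measurable_misclassified u : measurable_fun setT u ->
  measurable_fun setT (fun z : obs R p => z.2 != u z.1).
Proof.
by move=> mu; apply: measurable_neqb => //; exact: (measurableT_comp mu measurable_fst).
Qed.

Lemma measurable_error u : measurable_fun setT u ->
  measurable_fun setT (fun w => (XY w).2 != u (XY w).1).
Proof.
move=> /measurable_misclassified mu.
by apply: (measurableT_comp mu); exact: measurable_funPT.
Qed.

Lemma error_integral u : measurable_fun setT u ->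
  P.-integrable setT (fun w => (((XY w).2 != u (XY w).1)%:R : R)%:E) /\
  \int[P]_w ((XY w).2 != u (XY w).1)%:R = error u.
Proof. by move=> mu; exact: integral_bool (measurable_error mu). Qed.

Lemma integrable_affine (A : set Omega) (f : Omega -> R) a b :
  measurable A -> P.-integrable setT (EFin \o f) ->
  P.-integrable A (EFin \o (fun w => a * f w + b)).
Proof.
move=> mA fi; apply: (@integrableS _ _ _ _ setT) => //.
rewrite (_ : EFin \o _ = (fun w => a%:E * (EFin \o f) w)%E \+ (EFin \o cst b)) //.
apply: integrableD => //; first exact: integrableZl.
exact: finite_measure_integrable_cst.
Qed.

Lemma Rintegral_affine (A : set Omega) (f : Omega -> R) a b :
  measurable A -> P.-integrable setT (EFin \o f) ->
  \int[P]_(w in A) (a * f w + b) = a * \int[P]_(w in A) f w + b * fine (P A).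
Proof.
move=> mA fi; have fA : P.-integrable A (EFin \o f) by exact: integrableS fi.
rewrite RintegralD//; last 2 first.
- have := integrable_affine a 0 mA fi.
  by under eq_fun do rewrite addr0.
- exact: finite_measure_integrable_cst.
by rewrite RintegralZl// Rintegral_cst.
Qed.

Section Bayes.
Variables (r : p.-tuple R -> R) (h : R).
Hypotheses (r_reg : is_regression P XY r) (r_margin : margin r h).

Lemma measurable_bayes : measurable_fun setT (bayes r).
Proof. by have [mr _] := r_reg; apply: measurable_fun_ler. Qed.

Lemma Rintegral_regression (B : set (p.-tuple R)) a b : measurable B ->
  \int[P]_(w in [set w | B (XY w).1]) (a * (XY w).2%:R + b) =
  \int[P]_(w in [set w | B (XY w).1]) (a * r (XY w).1 + b).
Proof.
move=> mB; have [_ [iY ir _ /(_ _ mB) E]] := r_reg.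
have mA : measurable [set w | B (XY w).1] by rewrite -[X in measurable X]setTI; exact: mX.
rewrite !Rintegral_affine//; congr (_ * _ + _).
by rewrite /Rintegral; congr fine; exact/esym.
Qed.

(** Where u and the Bayes classifier disagree, the difference of their errors is
    2 * Y - 1 up to the sign that makes its conditional expectation
    `|2 * r X - 1|, which is at least h.  The two signs are integrated
    separately, over the events A true and A false, which belong to sigma(X). *)
Lemma margin_loss u : measurable_fun setT u ->
  h * fine (P [set w | u (XY w).1 != bayes r (XY w).1]) <=
  loss P XY (bayes r) u.
Proof.
move=> mu; have ms := measurable_bayes.
pose B (c : bool) := [set x | (u x == ~~ c) && (bayes r x == c)].
have mB c : measurable (B c).
  rewrite /B; case: c; apply: measurable_set_bool.
    rewrite (_ : (fun _ => _) = fun x => ~~ u x && bayes r x).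
      by apply: measurable_and => //; exact: measurable_neg.
    by apply/funext => x; case: (u x); case: (bayes r x).
  rewrite (_ : (fun _ => _) = fun x => u x && ~~ bayes r x).
    by apply: measurable_and => //; exact: measurable_neg.
  by apply/funext => x; case: (u x); case: (bayes r x).
pose A c := [set w | B c (XY w).1].
have mA c : measurable (A c) by rewrite -[X in measurable X]setTI; exact: mX.
have side c : h * fine (P (A c)) <=
    \int[P]_(w in A c) ((if c then 2 else - 2) * (XY w).2%:R + (if c then -1 else 1)).
  rewrite (Rintegral_regression _ _ (mB c)) -Rintegral_cst//.
  have [_ [_ ir _ _]] := r_reg.
  apply: le_Rintegral => //; first exact: finite_measure_integrable_cst.
    exact: (integrable_affine _ _ (mA c) ir).
  move=> w [/andP[_ /eqP]] ; have := r_margin (XY w).1; rewrite /bayes.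
  case: c => [+ rs|+ /negbT]; last rewrite -ltNge => + rs.
    by rewrite ger0_norm; lra.
  by rewrite ltr0_norm; lra.
pose f c w : R := (if c then 2 else - 2) * (XY w).2%:R + (if c then -1 else 1).
have fi c : P.-integrable setT (EFin \o (f c \_ (A c))).
  rewrite -restrict_EFin; apply/(integrable_mkcond (EFin \o f c) (mA c)).
  by have [_ [iY _ _ _]] := r_reg; exact: (integrable_affine _ _ (mA c) iY).
have -> : fine (P [set w | u (XY w).1 != bayes r (XY w).1]) =
    fine (P (A true)) + fine (P (A false)).
  rewrite -fineD ?fin_num_measure// -measureU//.
    congr (fine (P _)); apply/seteqP; split=> w /=; rewrite /A /B /=.
      by case: (u _); case: (bayes _ _) => //= _; [right|left].
    by case=> /andP[/eqP -> /eqP ->].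
  apply/seteqP; split=> w //=; rewrite /A /B /=.
  by case=> /andP[/eqP -> _] /andP[].
have -> : loss P XY (bayes r) u =
    \int[P]_(w in A true) f true w + \int[P]_(w in A false) f false w.
  rewrite /loss -/(error u) -/(error (bayes r)).
  have [iu <-] := error_integral mu; have [ib <-] := error_integral ms.
  rewrite -RintegralB// !(Rintegral_mkcond P (A _)) -RintegralD//.
  apply: eq_Rintegral => w _; rewrite /patch /f /A.
  have wA c : (w \in [set w | B c (XY w).1]) =
      (u (XY w).1 == ~~ c) && (bayes r (XY w).1 == c).
    by apply/idP/idP => [/set_mem//|H]; exact/mem_set.
  rewrite !wA -[point]/(0 : R).
  by case: (u _); case: (bayes _ _); case: (XY w).2 => /=; lra.
by rewrite mulrDr lerD// side.
Qed.

Lemma loss_ge0_le1 u : measurable_fun setT u -> 0 <= h ->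
  0 <= loss P XY (bayes r) u <= 1.
Proof.
move=> mu h0; apply/andP; split.
  by apply: le_trans (margin_loss mu); rewrite mulr_ge0// fine_ge0.
rewrite /loss lerBlDr -[leLHS]addr0 lerD ?fine_ge0//.
have mE := measurable_set_bool (measurable_error mu).
by rewrite -lee_fin fineK ?fin_num_measure// probability_le1.
Qed.

(** The bound r <= 1 holds only almost surely, so the margin condition is not used
    at a single point: the loss of the classifier opposite to the Bayes one is at
    least h and at most 1. *)
Lemma margin_le1 : 0 <= h -> h <= 1.
Proof.
move=> h0; have ms := measurable_bayes.
have mu : measurable_fun setT (fun x => ~~ bayes r x) by exact: measurable_neg.
have := margin_loss mu.
rewrite (_ : mkset _ = setT); last first.
  by apply/seteqP; split=> w //= _; case: (bayes _ _).
rewrite probability_setT/= mulr1 => /le_trans; apply.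
by case/andP: (loss_ge0_le1 mu h0).
Qed.

End Bayes.
End Margin.

(** * The hold-out inequality for fixed candidates *)

Lemma Rintegral_sum {d : measure_display} {T : measurableType d} {R : realType}
    (mu : {measure set T -> \bar R}) (I : eqType) (s : seq I) (f : I -> T -> R) :
  (forall i, i \in s -> mu.-integrable setT (EFin \o f i)) ->
  mu.-integrable setT (EFin \o (fun x => \sum_(i <- s) f i x)) /\
  \int[mu]_x (\sum_(i <- s) f i x) = \sum_(i <- s) \int[mu]_x f i x.
Proof.
elim: s => [_|i s IH fs].
  rewrite (_ : (fun _ => _) = cst 0); last by apply/funext => x; rewrite big_nil.
  rewrite big_nil; split; first exact: integrable0.
  by rewrite /Rintegral integral0.
have [int E] := IH (fun j js => fs j (mem_behead (s := i :: s) js)).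
have inti := fs i (mem_head _ _).
rewrite (_ : (fun _ => _) = f i \+ fun x => \sum_(j <- s) f j x); last first.
  by apply/funext => x; rewrite big_cons.
by rewrite big_cons RintegralD// E; split=> //; exact: (integrableD measurableT inti int).
Qed.

Lemma empirical_riskE (R : realType) (p n : nat) (D : sample R p n) u :
  empirical_risk D u =
  n%:R^-1 * \sum_(i < n) ((tnth D i).2 != u (tnth D i).1)%:R.
Proof.
congr (_ * _); apply: eq_bigr => i _.
by case: (_.2); case: (u _); rewrite /= ?subrr ?subr0 ?sub0r ?sqrrN ?expr1n ?expr0n.
Qed.

Section Holdout.
Context {d : measure_display} {Omega : measurableType d} {R : realType}.
Context {p : nat}.
Variables (P : probability Omega R) (XY : {RV P >-> obs R p}).

Lemma measurable_label_code (u v : classifier R p) (c : bool * bool) :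
  measurable_fun setT u -> measurable_fun setT v ->
  measurable ((fun z : obs R p => (z.2 != v z.1, z.2 != u z.1)) @^-1` [set c]).
Proof.
move=> mu mv; have mc : measurable_fun setT
      (fun z : obs R p => (z.2 != v z.1, z.2 != u z.1)).
  by apply: measurable_fun_pair; exact: measurable_misclassified.
rewrite -[_ @^-1` _]setTI (_ : [set c] = [set c.1] `*` [set c.2]).
  by apply: mc => //; apply: measurableX.
by apply/seteqP; split=> -[a b] /= => [<-|[-> ->]] //; case: c.
Qed.

(** The difference of two error indicators has absolute value the indicator of
    u <> v, so that it can be replaced by its second-order expansion. *)
Lemma exponential_moment (u v : classifier R p) (lam : R) :
  measurable_fun setT u -> measurable_fun setT v -> 0 <= lam <= 1 ->
  \int[P]_w expR (lam * (((XY w).2 != v (XY w).1)%:R - ((XY w).2 != u (XY w).1)%:R))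
  <= 1 + lam * (error XY v - error XY u)
     + lam ^+ 2 * fine (P [set w | u (XY w).1 != v (XY w).1]).
Proof.
move=> mu mv /andP[lam0 lam1].
have [iu <-] := error_integral XY mu; have [iv <-] := error_integral XY mv.
have mX : measurable_fun setT (fun w => (XY w).1).
  by apply: measurableT_comp => //; exact: measurable_funPT.
have [iuv <-] := integral_bool P (measurable_neqb
   (measurableT_comp mu mX) (measurableT_comp mv mX)).
have i1 : P.-integrable setT (EFin \o (fun=> 1 : R)).
  exact: finite_measure_integrable_cst.
rewrite -RintegralB// -[X in X + _ + _](Rintegral_cst_probability P).
have ib := integrableB measurableT iv iu.
rewrite -!RintegralZl//.
have ilb := integrableZl measurableT lam ib.
have iluv := integrableZl measurableT (lam ^+ 2) iuv.
rewrite -RintegralD// -RintegralD//; last exact: (integrableD measurableT i1 ilb).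
apply: le_Rintegral => //.
- apply: (integral_finite_valued P
      (k := fun w => ((XY w).2 != v (XY w).1, (XY w).2 != u (XY w).1))
      (fun c => expR (lam * (c.1%:R - c.2%:R))) _).1 => c.
  rewrite -[_ @^-1` _]setTI.
  exact: (measurable_funPT XY measurableT _ (measurable_label_code c mu mv)).
- exact: (integrableD measurableT (integrableD measurableT i1 ilb) iluv).
move=> w _ /=.
set y := (XY w).2; set a := u _; set b := v _.
apply: le_trans (expR_le_quadratic _) _.
  rewrite normrM ger0_norm// -[leRHS]mulr1 ler_pM//.
  by case: y; case: a; case: b; rewrite /= ?subrr ?subr0 ?sub0r ?normrN ?normr1 ?normr0.
rewrite exprMn; case: y; case: a; case: b => /=; lra.
Qed.

Section Inequality.
Variables (r : p.-tuple R -> R) (h : R).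
Hypotheses (r_reg : is_regression P XY r) (r_margin : margin r h) (h_gt0 : 0 < h).
Variables (n : nat) (Z : 'I_n -> {RV P >-> obs R p}).
Hypotheses (n_gt0 : (0 < n)%N)
  (Z_indep : mutually_independent P (fun i => Z i : Omega -> obs R p))
  (Z_law : forall i, same_law P (Z i) XY).

Let l := loss P XY (bayes r).

(** Where u and v differ, one of them differs from the Bayes classifier. *)
Lemma disagreement_le_losses u v : measurable_fun setT u -> measurable_fun setT v ->
  h * fine (P [set w | u (XY w).1 != v (XY w).1]) <= l u + l v.
Proof.
move=> mu mv; apply: le_trans (lerD (margin_loss r_reg r_margin mu)
  (margin_loss r_reg r_margin mv)).
have mX : measurable_fun setT (fun w => (XY w).1).
  by apply: measurableT_comp => //; exact: measurable_funPT.
have ms := measurable_bayes r_reg.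
have mE (a b : classifier R p) : measurable_fun setT a -> measurable_fun setT b ->
    measurable [set w | a (XY w).1 != b (XY w).1].
  move=> ma mb; apply: measurable_set_bool.
  exact: (measurable_neqb (measurableT_comp ma mX) (measurableT_comp mb mX)).
rewrite -mulrDr ler_pM2l// -fineD ?fin_num_measure//; [|exact: mE..].
apply: fine_le.
- by rewrite fin_num_measure//; exact: mE.
- by rewrite fin_numD !fin_num_measure//; exact: mE.
apply: (@le_trans _ _ (P ([set w | u (XY w).1 != bayes r (XY w).1] `|`
    [set w | v (XY w).1 != bayes r (XY w).1]))); last first.
  by apply: measureU2; exact: mE.
apply: le_measure; rewrite ?inE; [exact: mE|by apply: measurableU; exact: mE|].
by move=> w /=; case: (u _); case: (v _); case: (bayes r _) => //= _; by [left|right].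
Qed.

(** By independence this is the n-th power of [exponential_moment], where
    lam * P (u <> v) is bounded by eta * (l u + l v). *)
Lemma exponential_comparison u v lam eta :
  measurable_fun setT u -> measurable_fun setT v -> 0 <= lam -> lam <= eta * h ->
  0 <= eta <= 1 ->
  P.-integrable setT (EFin \o fun w => \prod_i expR (lam *
    (((Z i w).2 != v (Z i w).1)%:R - ((Z i w).2 != u (Z i w).1)%:R))) /\
  \int[P]_w \prod_i expR (lam *
    (((Z i w).2 != v (Z i w).1)%:R - ((Z i w).2 != u (Z i w).1)%:R))
  <= expR (- (n%:R * (lam * ((1 - eta) * l u - (1 + eta) * l v)))).
Proof.
move=> mu mv lam0 lameta /andP[eta0 eta1].
have h1 := margin_le1 r_reg r_margin (ltW h_gt0).
have [] := integral_prod_independent (e := fun z : obs R p => (z.2 != v z.1, z.2 != u z.1))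
  (fun c => expR (lam * (c.1%:R - c.2%:R))) Z_indep Z_law
  (fun c => measurable_label_code c mu mv).
move=> iprod ->; split=> //.
rewrite -mulrN expRM_natl card_ord ler_pXn2r// ?nnegrE ?expR_ge0//; last first.
  by apply: Rintegral_ge0 => w _; exact: expR_ge0.
apply: le_trans (exponential_moment mu mv _) _; first by rewrite lam0/=; nra.
apply: le_trans (expR_ge1Dx _).
have D : error XY v - error XY u = l v - l u by rewrite /l /loss /error; ring.
have V := disagreement_le_losses mu mv.
rewrite D -addrA lerD2l.
set q := fine _ in V *.
have q0 : 0 <= q by rewrite fine_ge0.
have : lam * q <= eta * (l u + l v) by nra.
nra.
Qed.

(** The constants c u normalize the exponentials expR (c u) * W u so that each
    has expectation at most 1.  Their average over G dominates the term of the
    selected classifier, which is bounded from below by 1 + x <= expR x. *)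
Lemma holdout_inequality (G : set (classifier R p))
    (e : sample R p n -> classifier R p) v eta :
  finite_set G -> (forall u, G u -> measurable_fun setT u) ->
  (forall D, is_minimizer G (empirical_risk D) (e D)) ->
  measurable_fun setT (fun w => l (e [tuple Z i w | i < n])) ->
  G v -> 0 < eta < 1 ->
  (1 - eta) * \int[P]_w l (e [tuple Z i w | i < n]) <=
    (1 + eta) * l v + ln (cardinality G)%:R / (n%:R * (eta * h)).
Proof.
move=> finG mG emin me Gv /andP[eta0 eta1].
have eta01 : 0 <= eta <= 1 by rewrite !ltW.
pose lam := eta * h; have lam0 : 0 < lam by rewrite mulr_gt0.
pose c u := n%:R * (lam * ((1 - eta) * l u - (1 + eta) * l v)).
pose W u w := \prod_i expR (lam *
    (((Z i w).2 != v (Z i w).1)%:R - ((Z i w).2 != u (Z i w).1)%:R)).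
pose s : seq (classifier R p) := fset_set G.
have sG u : (u \in s) = (u \in G) by rewrite /s in_fset_set.
have sGP u : u \in s -> G u by rewrite sG => /set_mem.
have K0 : 0 < (size s)%:R :> R.
  rewrite ltr0n; have : v \in s by rewrite sG mem_set.
  by case: (s).
have IW u (us : u \in s) := exponential_comparison (mG _ (sGP _ us)) (mG _ Gv) (ltW lam0) (lexx _) eta01.
have iw u : u \in s -> P.-integrable setT (EFin \o (fun w => expR (c u) * W u w)).
  by move=> us; exact: (integrableZl measurableT (expR (c u)) (IW u us).1).
have [iS ES] := Rintegral_sum iw.
have risk_sample w u : empirical_risk [tuple Z i w | i < n] u =
    n%:R^-1 * \sum_(i < n) ((Z i w).2 != u (Z i w).1)%:R.
  by rewrite empirical_riskE; congr (_ * _); apply: eq_bigr => i _; rewrite tnth_mktuple.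
pose le w := l (e [tuple Z i w | i < n]).
have ile : P.-integrable setT (EFin \o le).
  apply: measurable_bounded_integrable => //; first by rewrite ltey_eq fin_num_measure.
  exists 1; split=> // x x1 w _.
  have [Ge _] := emin [tuple Z i w | i < n].
  have /andP[l0 l1] := loss_ge0_le1 r_reg r_margin (mG _ Ge) (ltW h_gt0).
  by rewrite /= ger0_norm// (le_trans l1)// ltW.
have pointwise w : n%:R * lam * (1 - eta) * le w +
     (1 - n%:R * lam * (1 + eta) * l v - ln (size s)%:R) <=
    (size s)%:R^-1 * \sum_(u <- s) expR (c u) * W u w.
  set D := [tuple Z i w | i < n].
  have [Ge emin_w] := emin D.
  have es : e D \in s by rewrite sG mem_set.
  (* e D has at most as many errors as v on the sample *)
  have W1 : 1 <= W (e D) w.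
    rewrite /W -expR_sum -[leLHS]expR0 ler_expR -mulr_sumr pmulr_rge0// sumrB subr_ge0.
    by have := emin_w v Gv; rewrite !risk_sample ler_pM2l ?invr_gt0 ?ltr0n.
  apply: (@le_trans _ _ ((size s)%:R^-1 * (expR (c (e D)) * W (e D) w))); last first.
    rewrite ler_pM2l ?invr_gt0// (bigD1_seq _ es) ?fset_uniq//= lerDl.
    by apply: sumr_ge0 => u _; rewrite mulr_ge0 ?expR_ge0// prodr_ge0// => i _; exact: expR_ge0.
  apply: (@le_trans _ _ ((size s)%:R^-1 * expR (c (e D)))); last first.
    by rewrite ler_pM2l ?invr_gt0// ler_peMr// expR_ge0.
  have -> : (size s)%:R^-1 * expR (c (e D)) = expR (c (e D) - ln (size s)%:R).
    by rewrite expRB lnK ?posrE// mulrC.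
  apply: le_trans (expR_ge1Dx _).
  by rewrite /c /le -/D; lra.
have := le_Rintegral measurableT (integrable_affine (n%:R * lam * (1 - eta))
  (1 - n%:R * lam * (1 + eta) * l v - ln (size s)%:R) measurableT ile)
  (integrableZl measurableT (size s)%:R^-1 iS) (fun w _ => pointwise w).
rewrite Rintegral_affine// RintegralZl// ES.
have S1 : (size s)%:R^-1 * \sum_(u <- s) \int[P]_w (expR (c u) * W u w) <= 1.
  rewrite ler_pdivrMl// mulr1 -sum1_size natr_sum big_seq [leRHS]big_seq ler_sum// => u us.
  have [i1 i2] := IW u us; rewrite RintegralZl//.
  apply: (@le_trans _ _ (expR (c u) * expR (- c u))); last by rewrite expRxMexpNx_1.
  by rewrite ler_pM2l ?expR_gt0.
move=> /le_trans /(_ S1).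
have -> : fine (P setT) = 1 by rewrite probability_setT.
rewrite mulr1 => H.
have nl : 0 < n%:R * lam by rewrite mulr_gt0// ltr0n.
rewrite -(ler_pM2l nl) mulrDr -/lam.
by rewrite [X in _ <= _ + X]mulrCA divff ?gt_eqF// mulr1; lra.
Qed.
End Inequality.
End Holdout.

(** * Conditional expectation given an independent sample *)

Section ConditionalExpectation.
Context {d : measure_display} {Omega : measurableType d} {R : realType}.
Variable P : probability Omega R.
Context {d1 d2 : measure_display} {T1 : measurableType d1} {T2 : measurableType d2}.

(** The event V' < V belongs to sigma(L), so V and V' have the same integral
    over it, which forces it to be negligible. *)
Lemma cond_expectation_le (L : Omega -> T1) (f V V' : Omega -> R) :
  measurable_fun setT L ->
  is_cond_expectation P L f V -> is_cond_expectation P L f V' ->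
  {ae P, forall w, V w <= V' w}.
Proof.
move=> mL [_ iV sV VE] [_ iV' sV' V'E].
have toL (X : Omega -> R) : (forall A : set R, measurable A ->
      preimage_set_system setT L measurable (X @^-1` A)) ->
    measurable_fun setT (X : g_sigma_algebra_preimageType L -> R).
  by move=> sX _ A mA; rewrite setTI; exact: sX.
have [B mB BE] : preimage_set_system setT L measurable [set w | V' w < V w].
  exact: (measurable_set_bool (measurable_fun_ltr (toL _ sV') (toL _ sV))).
rewrite setTI in BE; pose D := L @^-1` B.
have mD : measurable D by rewrite -[D]setTI; exact: mL.
have iVD : P.-integrable D (EFin \o V) by exact: integrableS iV.
have iV'D : P.-integrable D (EFin \o V') by exact: integrableS iV'.
have I0 : (\int[P]_(w in D) `|((EFin \o V) \- (EFin \o V')) w|)%E = 0%E.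
  transitivity (\int[P]_(w in D) ((EFin \o V) \- (EFin \o V')) w)%E.
    apply: eq_integral => w; rewrite inE /D BE /= => ltV.
    by rewrite ger0_norm ?subr_ge0 ?ltW.
  rewrite integralB// VE// V'E// subee//.
  by rewrite -VE//; exact: integrable_fin_num.
have mI : measurable_fun D ((EFin \o V) \- (EFin \o V'))%E.
  exact: (measurable_int P (integrableB mD iVD iV'D)).
apply: filterS ((ae_eq_integral_abs P mD mI).1 I0) => w Dw.
rewrite leNgt; apply/negP => ltV.
have : D w by rewrite /D BE.
by move/Dw => /= -[] /eqP; rewrite subr_eq0 gt_eqF.
Qed.

(** Independence says that the law of (L, M) is the product of the laws of L and
    M, so that the identity over sigma(L) is Fubini's theorem. *)
Lemma cond_expectation_independent (L : {RV P >-> T1}) (M : {RV P >-> T2})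
    (f : T1 * T2 -> R) (C : R) :
  (forall A B, measurable A -> measurable B ->
    P ((L @^-1` A) `&` (M @^-1` B)) = (P (L @^-1` A) * P (M @^-1` B))%E) ->
  measurable_fun setT f -> (forall z, `|f z| <= C) ->
  is_cond_expectation P L (fun w => f (L w, M w))
    (fun w => \int[P]_w' f (L w, M w')).
Proof.
move=> indLM mf fC.
have mLM : measurable_fun setT (fun w => (L w, M w)).
  by apply: measurable_fun_pair; exact: measurable_funPT.
pose LM : {RV P >-> (T1 * T2)%type} := HB.pack (fun w => (L w, M w))
  (isMeasurableFun.Build _ _ _ _ _ mLM).
pose m1 := distribution P L; pose m2 := distribution P M.
have m12 (X : set (T1 * T2)) : measurable X -> (m1 \x m2)%E X = distribution P LM X.
  apply: product_measure_unique => A B mA mB.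
  by rewrite -indLM.
have bounded_integrable d' (T : measurableType d') (mu : {measure set T -> \bar R})
    (g : T -> R) : (mu setT < +oo)%E -> measurable_fun setT g ->
    (forall z, `|g z| <= C) -> mu.-integrable setT (EFin \o g).
  move=> muoo mg gC; apply: measurable_bounded_integrable => //.
  exists C; split; first exact: num_real.
  by move=> x Cx z _ /=; rewrite (le_trans (gC z))// ltW.
have Poo : (P setT < +oo)%E by rewrite ltey_eq fin_num_measure.
have m12oo : ((m1 \x m2)%E setT < +oo)%E.
  by rewrite m12// ltey_eq fin_num_measure.
have sectM x (g : T1 * T2 -> R) : measurable_fun setT g -> (forall z, `|g z| <= C) ->
    (\int[m2]_y (g (x, y))%:E = (\int[P]_w g (x, M w))%:E)%E.
  move=> mg gC; have mgx : measurable_fun setT (g \o pair x).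
    exact: (measurableT_comp mg (pair1_measurable x)).
  have ig : P.-integrable setT (EFin \o (fun w => g (x, M w))).
    apply: bounded_integrable => //.
    exact: (measurableT_comp mgx (measurable_funPT M)).
  rewrite (@integral_distribution _ _ _ _ _ P M (EFin \o (g \o pair x)))//.
    by rewrite fineK//; exact: integrable_fin_num.
  exact/measurable_EFinP.
have if12 : (m1 \x m2)%E.-integrable setT (EFin \o f) by exact: bounded_integrable.
pose g x := \int[P]_w f (x, M w).
have gE : fubini_F m2 (EFin \o f) = EFin \o g.
  by apply/funext => x; rewrite /fubini_F /= sectM.
have mg : measurable_fun setT g.
  by apply/measurable_EFinP; rewrite -gE; exact: measurable_fubini_F if12.
have if_section x : P.-integrable setT (EFin \o (fun w => f (x, M w))).
  apply: bounded_integrable => //.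
  exact: (measurableT_comp (measurableT_comp mf (pair1_measurable x)) (measurable_funPT M)).
have gC x : `|g x| <= C.
  apply: le_trans (le_normr_Rintegral measurableT (if_section x)) _.
  rewrite -[leRHS](Rintegral_cst_probability P).
  apply: le_Rintegral => //; first exact: integrable_norm.
  exact: finite_measure_integrable_cst.
change (is_cond_expectation P L (f \o LM) (g \o L)); split.
- apply: bounded_integrable; [exact: Poo|exact: (measurableT_comp mf mLM)|].
  by move=> w; exact: fC.
- apply: bounded_integrable; [exact: Poo|exact: (measurableT_comp mg (measurable_funPT L))|].
  by move=> w; exact: gC.
- move=> A mA; exists (g @^-1` A); last by rewrite setTI.
  by rewrite -[_ @^-1` _]setTI; exact: mg.
move=> B mB; pose fB (z : T1 * T2) := f z * \1_B z.1.
have mfB : measurable_fun setT fB.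
  by apply: measurable_funM => //; apply: measurableT_comp => //; exact: measurable_indic.
have fBC z : `|fB z| <= C.
  rewrite normrM -[leRHS]mulr1 ler_pM// indicE.
  by case: (_ \in _); rewrite ?normr1 ?normr0.
have cutE (F : Omega -> R) : ((EFin \o F) \_ (L @^-1` B)) = EFin \o (fun w => F w * \1_B (L w)).
  apply/funext => w; rewrite /patch /= indicE.
  have -> : (w \in L @^-1` B) = (L w \in B) by apply/idP/idP => /set_mem Bw; exact/mem_set.
  by case: (_ \in _); rewrite ?mulr1 ?mulr0.
rewrite [LHS]integral_mkcond [RHS]integral_mkcond !cutE.
have if12B : (m1 \x m2)%E.-integrable setT (EFin \o fB) by exact: bounded_integrable.
transitivity (\int[m1]_x (g x * \1_B x)%:E)%E.
  rewrite (@integral_distribution _ _ _ _ _ P L (fun x => (g x * \1_B x)%:E))//.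
    apply/measurable_EFinP; apply: measurable_funM => //; exact: measurable_indic.
  apply: bounded_integrable => //.
    apply: measurable_funM; first exact: (measurableT_comp mg (measurable_funPT L)).
    exact: (measurableT_comp (measurable_indic mB) (measurable_funPT L)).
  move=> w; rewrite normrM -[leRHS]mulr1 ler_pM// indicE.
  by case: (_ \in _); rewrite ?normr1 ?normr0.
transitivity (\int[m1 \x m2]_z (fB z)%:E)%E.
  rewrite -(integral12_prod_meas1 if12B); apply: eq_integral => x _.
  by rewrite /fubini_F sectM// /fB/= RintegralZr.
rewrite (eq_measure_integral (distribution P LM)); last by move=> A mA _; exact: m12.
rewrite (@integral_distribution _ _ _ _ _ P LM (EFin \o fB))//.
  exact/measurable_EFinP.
apply: bounded_integrable; [exact: Poo|exact: (measurableT_comp mfB mLM)|].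
by move=> w; exact: fBC.
Qed.

End ConditionalExpectation.

(** * The oracle inequality *)

(** The passage to the constants of the theorem, which are larger:
    eta^-1 <= 3^-1 + eta^-1, and the last term is nonnegative. *)
Lemma weaken_constants (R : realType) (I m k N h eta : R) :
  0 < N -> 0 < h -> 0 < eta < 1 -> 0 <= k ->
  (1 - eta) * I <= (1 + eta) * m + k / (N * (eta * h)) ->
  I <= (1 + eta) / (1 - eta) * m + (3^-1 + eta^-1) * (1 - eta)^-1 / (N * h) * k
     + (2 * eta + 3^-1 + eta^-1) / (1 - eta) / (N * h).
Proof.
move=> N0 h0 /andP[eta0 eta1] k0; have e1 : 0 < 1 - eta by rewrite subr_gt0.
rewrite mulrC -ler_pdivlMr// => /le_trans; apply.
have c0 : 0 <= (2 * eta + 3^-1 + eta^-1) / (1 - eta) / (N * h).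
  have ei : 0 < eta^-1 by rewrite invr_gt0.
  by rewrite divr_ge0 ?mulr_ge0 ?ltW ?mulr_gt0 ?invr_gt0//; lra.
apply: le_trans (lerD (lexx _) c0); rewrite addr0.
rewrite [leLHS]mulrDl [X in X + _ <= _]mulrAC lerD2l.
have -> : k / (N * (eta * h)) / (1 - eta) = eta^-1 * ((1 - eta)^-1 / (N * h) * k).
  by field; rewrite ?gt_eqF.
rewrite [leRHS](_ : _ = (3^-1 + eta^-1) * ((1 - eta)^-1 / (N * h) * k)); last first.
  by rewrite !mulrA.
apply: ler_wpM2r; last by rewrite lerDr.
by rewrite mulr_ge0// divr_ge0 ?invr_ge0 ?mulr_ge0 ?ltW.
Qed.

Theorem proposition3 (R : realType) (d : measure_display)
  (Omega : measurableType d) (P : probability Omega R)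
  (p n1 n2 n3 : nat)
  (p_gt0 : (0 < p)%N) (n1_gt0 : (0 < n1)%N) (n2_gt0 : (0 < n2)%N)
  (n3_gt0 : (0 < n3)%N)
  (* the generic pair (X, Y) *)
  (XY : {RV P >-> (p.-tuple R * bool)%type})
  (* the training sample, split into three subsamples *)
  (Z : ('I_n1 + 'I_n2 + 'I_n3)%type -> {RV P >-> (p.-tuple R * bool)%type})
  (Z_indep : mutually_independent P (fun i => Z i : Omega -> _))
  (Z_law : forall i, same_law P (Z i) XY)
  (L1 : Omega -> n1.-tuple (p.-tuple R * bool))
  (L1E : forall w, L1 w = [tuple Z (inl (inl i)) w | i < n1])
  (L2 : Omega -> n2.-tuple (p.-tuple R * bool))
  (L2E : forall w, L2 w = [tuple Z (inl (inr i)) w | i < n2])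
  (L3 : Omega -> n3.-tuple (p.-tuple R * bool))
  (L3E : forall w, L3 w = [tuple Z (inr i) w | i < n3])
  (* regression function, margin, loss *)
  (r : p.-tuple R -> R) (r_reg : is_regression P XY r)
  (h : R) (h_gt0 : 0 < h) (r_margin : margin r h)
  (l : (p.-tuple R -> bool) -> R)
  (lE : forall u, l u = loss P XY (bayes r) u)
  (* maximal trees, penalized estimators *)
  (phi : R -> R) (phi_imp : is_impurity phi)
  (alpha0 beta0 : R) (alpha0_gt0 : 0 < alpha0) (beta0_gt0 : 0 < beta0)
  (Tmax : n1.-tuple (p.-tuple R * bool) -> {set 'I_p} -> tree R p)
  (Tmax_cart : is_maximal_tree_rule phi Tmax)
  (shat : n1.-tuple (p.-tuple R * bool) -> n2.-tuple (p.-tuple R * bool) ->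
          {set 'I_p} * tree R p -> p.-tuple R -> bool)
  (shat_erm : is_erm_rule Tmax shat)
  (sel : n1.-tuple (p.-tuple R * bool) -> n2.-tuple (p.-tuple R * bool) ->
         R -> R -> {set 'I_p} * tree R p)
  (sel_min : is_selection_rule Tmax shat h alpha0 beta0 sel)
  (* the final estimator, whose loss is a random variable *)
  (sfinal : n1.-tuple (p.-tuple R * bool) -> n2.-tuple (p.-tuple R * bool) ->
            n3.-tuple (p.-tuple R * bool) -> p.-tuple R -> bool)
  (sfinal_min : is_holdout_rule shat sel alpha0 beta0 sfinal)
  (sfinal_meas : measurable_fun setT
     (fun D : n1.-tuple (p.-tuple R * bool) * n2.-tuple (p.-tuple R * bool) *
              n3.-tuple (p.-tuple R * bool) =>
        l (sfinal D.1.1 D.1.2 D.2))) :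
  (forall D1 D2, finite_set (candidates shat sel alpha0 beta0 D1 D2)) /\
  forall eta : R, 0 < eta < 1 ->
  forall V : Omega -> R,
    is_cond_expectation P (fun w => (L1 w, L2 w))
      (fun w => l (sfinal (L1 w) (L2 w) (L3 w))) V ->
    {ae P, forall w,
       V w <= (1 + eta) / (1 - eta)
              * inf [set v | exists alpha beta,
                       [/\ alpha0 < alpha, beta0 < beta
                         & v = l (stilde shat sel (L1 w) (L2 w) alpha beta)]]
            + (3^-1 + eta^-1) * (1 - eta)^-1 / (n3%:R * h)
              * ln (cardinality
                      (candidates shat sel alpha0 beta0 (L1 w) (L2 w)))%:R
            + (2 * eta + 3^-1 + eta^-1) / (1 - eta) / (n3%:R * h)}.
Proof.
split=> [D1 D2|eta eta01 V VE]; first exact: finite_candidates shat_erm sel_min.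
have h0 := ltW h_gt0.
have l01 D1 D2 D3 : 0 <= l (sfinal D1 D2 D3) <= 1.
  rewrite lE; apply: (loss_ge0_le1 r_reg r_margin _ h0).
  by have [] := sfinal_min D1 D2 D3 => /(candidates_measurable shat_erm sel_min).
pose Jpast := [set i : 'I_n1 + 'I_n2 + 'I_n3 | if i is inl _ then true else false]%SET.
pose Jlast := [set i : 'I_n1 + 'I_n2 + 'I_n3 | if i is inr _ then true else false]%SET.
have past_measurable : measurable_fun setT
    ((fun w => (L1 w, L2 w)) : g_sigma_algebraType (cylinders Z Jpast) -> _).
  apply: measurable_fun_pair; apply/measurable_fun_tnthP => i.
    rewrite (_ : _ \o _ = Z (inl (inl i))); last first.
      by apply/funext => w /=; rewrite L1E tnth_mktuple.
    by apply: measurable_block; rewrite inE.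
  rewrite (_ : _ \o _ = Z (inl (inr i))); last first.
    by apply/funext => w /=; rewrite L2E tnth_mktuple.
  by apply: measurable_block; rewrite inE.
have last_measurable : measurable_fun setT
    (L3 : g_sigma_algebraType (cylinders Z Jlast) -> _).
  apply/measurable_fun_tnthP => i.
  rewrite (_ : _ \o _ = Z (inr i)); last first.
    by apply/funext => w /=; rewrite L3E tnth_mktuple.
  by apply: measurable_block; rewrite inE.
have sub J : <<s cylinders Z J >> `<=` measurable.
  by apply: smallest_sub; [exact: sigma_algebra_measurable|exact: measurable_cylinder].
have mL12 : measurable_fun setT (fun w => (L1 w, L2 w)).
  by move=> _ A mA; apply: sub; exact: past_measurable.
have mL3 : measurable_fun setT L3.
  by move=> _ A mA; apply: sub; exact: last_measurable.
pose L12 : {RV P >-> (n1.-tuple (p.-tuple R * bool) * n2.-tuple (p.-tuple R * bool))%type} :=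
  HB.pack (fun w => (L1 w, L2 w)) (isMeasurableFun.Build _ _ _ _ _ mL12).
pose L3' : {RV P >-> n3.-tuple (p.-tuple R * bool)} :=
  HB.pack L3 (isMeasurableFun.Build _ _ _ _ _ mL3).
have ind A B : measurable A -> measurable B ->
    P ((L12 @^-1` A) `&` (L3' @^-1` B)) = (P (L12 @^-1` A) * P (L3' @^-1` B))%E.
  move=> mA mB; apply: (@blocks_independent _ _ _ _ _ _ _ Z Jpast Jlast) => //.
  - by apply/pred0P => -[i|i]; rewrite !inE.
  - by rewrite -[_ @^-1` _]setTI; exact: past_measurable.
  - by rewrite -[_ @^-1` _]setTI; exact: last_measurable.
have lb z : `|l (sfinal z.1.1 z.1.2 z.2)| <= 1.
  by have /andP[l0 l1] := l01 z.1.1 z.1.2 z.2; rewrite ger0_norm.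
have VE' := cond_expectation_independent ind sfinal_meas lb.
apply: filterS (cond_expectation_le mL12 VE VE') => w /le_trans; apply => /=.
(* From here on the first two subsamples are fixed, and only w' is random. *)
set D1 := L1 w; set D2 := L2 w.
pose G := candidates shat sel alpha0 beta0 D1 D2.
pose Z3 i := Z (inr i).
have indZ3 : mutually_independent P (fun i => Z3 i : Omega -> _).
  by apply: (mutually_independent_comp (f := inr) _ Z_indep) => i j [].
have L3Z w' : L3 w' = [tuple Z3 i w' | i < n3] by rewrite L3E.
have mfin : measurable_fun setT (fun w' => loss P XY (bayes r) (sfinal D1 D2 [tuple Z3 i w' | i < n3])).
  rewrite (_ : (fun _ => _) = (fun z => l (sfinal z.1.1 z.1.2 z.2)) \o pair (D1, D2) \o L3).
    exact: (measurableT_comp (measurableT_comp sfinal_meas (pair1_measurable _)) mL3).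
  by apply/funext => w' /=; rewrite lE L3Z.
have key v : G v -> (1 - eta) * \int[P]_w' l (sfinal D1 D2 (L3 w')) <=
    (1 + eta) * l v + ln (cardinality G)%:R / (n3%:R * (eta * h)).
  move=> Gv; rewrite lE.
  rewrite (_ : (fun w' => _) = fun w' => loss P XY (bayes r) (sfinal D1 D2 [tuple Z3 i w' | i < n3])).
    apply: (holdout_inequality r_reg r_margin h_gt0 n3_gt0 indZ3 (fun i => Z_law (inr i))) => //.
    - exact: finite_candidates shat_erm sel_min.
    - by move=> u; exact: candidates_measurable shat_erm sel_min.
    - exact: sfinal_min.
  by apply/funext => w'; rewrite lE L3Z.
apply: weaken_constants => //; first by rewrite ltr0n.
  by case: (cardinality _) => [|k]; [rewrite ln0|rewrite ln_ge0// ler1n].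
have [eta0 eta1] := andP eta01.
have e1 : 0 < 1 + eta by rewrite addr_gt0.
rewrite -lerBlDr -ler_pdivrMl//.
apply: lb_le_inf.
  exists (l (stilde shat sel D1 D2 (alpha0 + 1) (beta0 + 1))), (alpha0 + 1), (beta0 + 1).
  by rewrite !ltrDl ltr01.
move=> _ [a [b [aa bb ->]]]; rewrite ler_pdivrMl// lerBlDr.
by apply: key; exists a, b.
Qed.
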